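(* Let $\Gamma\in\mathbb{N}$ and let $h\in C^1([-\Gamma,\Gamma])$ be real-valued with $h'$ Lipschitz and $h(0)=0$. Then there is a constant $C>0$, depending only on $h$ and $\Gamma$, such that the following holds. Let $G_1,G_2$ be graphs with $n_1$ and $n_2$ nodes, GSOs $\mathbf{\Delta}_1\in\mathbb{R}^{n_1\times n_1}$, $\mathbf{\Delta}_2\in\mathbb{R}^{n_2\times n_2}$ and GWMs $\boldsymbol{A}_1,\boldsymbol{A}_2$ with $\|\boldsymbol{A}_1\|_{\mathbb{C}^{n_1}\to\mathbb{C}^{n_1}}\le\Gamma$ and $\|\boldsymbol{A}_2\|_{\mathbb{C}^{n_2}\to\mathbb{C}^{n_2}}\le\Gamma$. Then for all permutations $\pi_1,\pi_2$ of the node sets, $$\|T_{W_{n_1h(\pi_1(\mathbf{\Delta}_1))}}-T_{W_{n_2h(\pi_2(\mathbf{\Delta}_2))}}\|_{L^2[0,1]\to L^2[0,1]}\le C\,\|T_{W_{\pi_1(\boldsymbol{A}_1)}}-T_{W_{\pi_2(\boldsymbol{A}_2)}}\|_{L^2[0,1]\to L^2[0,1]}.$$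
   Context: A graph with GSO is $G=(V,E,\mathbf{\Delta})$, $V=\{1,\dots,n\}$, $\mathbf{\Delta}\in\mathbb{R}^{n\times n}$ symmetric; GWM $\boldsymbol{A}=n\mathbf{\Delta}$. $h(\mathbf{\Delta})$ is functional calculus via an orthonormal eigendecomposition (the eigenvalues of $\mathbf{\Delta}$ lie in $[-\Gamma,\Gamma]$ under the hypotheses). For a permutation $\pi$, $\pi(\boldsymbol{B})=(\boldsymbol{B}_{\pi(i)\pi(j)})_{ij}$. With $P_k=[(k-1)/n,k/n)$, $W_{\boldsymbol{B}}(u,v)=\sum_{i,j}\boldsymbol{B}_{ij}\chi_{P_i}(u)\chi_{P_j}(v)$ for $\boldsymbol{B}\in\mathbb{R}^{n\times n}$, and $T_W\psi(v)=\int_0^1W(v,u)\psi(u)du$ on $L^2[0,1]$. *)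

(* Defs.v *)
From HB Require Import structures.
From mathcomp Require Import all_boot all_order all_algebra perm.
From mathcomp Require Import all_classical all_reals all_analysis.
From mathcomp Require Import complex.

Set Implicit Arguments.
Unset Strict Implicit.
Unset Printing Implicit Defensive.

Import Order.TTheory GRing.Theory Num.Theory numFieldNormedType.Exports.
Local Open Scope classical_set_scope.
Local Open Scope ring_scope.

Section GraphonDefs.
Variable R : realType.

Definition cvnorm (n : nat) (x : 'cV[R[i]]_n) : R :=
  Num.sqrt (\sum_(k < n) (Normc.normc (x k ord0)) ^+ 2).

Definition cmx (n : nat) (A : 'M[R]_n) : 'M[R[i]]_n :=
  map_mx (fun r : R => (r%:C)%C) A.

Definition opnormC (n : nat) (A : 'M[R]_n) : \bar R :=
  ereal_sup [set (cvnorm (cmx A *m x))%:E | x in [set x : 'cV[R[i]]_n | cvnorm x <= 1]].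

Definition symmx (n : nat) (D : 'M[R]_n) : Prop := D^T = D.

Definition fcalc_of (h : R -> R) (n : nat) (D F : 'M[R]_n) : Prop :=
  exists (U : 'M[R]_n) (d : 'rV[R]_n),
    [/\ U^T *m U = 1%:M, U *m U^T = 1%:M,
        D = U^T *m diag_mx d *m U &
        F = U^T *m diag_mx (map_mx h d) *m U].

(* Functional calculus h(D) (a chosen orthonormal eigendecomposition;
   the result does not depend on the choice). *)
Definition fcalc (h : R -> R) (n : nat) (D : 'M[R]_n) : 'M[R]_n :=
  xget 0 [set F | fcalc_of h D F].

Definition permmx (n : nat) (p : {perm 'I_n}) (B : 'M[R]_n) : 'M[R]_n :=
  \matrix_(i, j) B (p i) (p j).

Definition I01 : set R := `[(0 : R), 1].

(* indicator of P_{k+1} = [k/n, (k+1)/n)  (0-indexed nodes k : 'I_n) *)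
Definition chiP (n : nat) (k : 'I_n) (u : R) : R :=
  if (k%:R / n%:R <= u) && (u < k.+1%:R / n%:R) then 1 else 0.

Definition stepW (n : nat) (B : 'M[R]_n) (u v : R) : R :=
  \sum_(i < n) \sum_(j < n) B i j * chiP i u * chiP j v.

Definition TW (W : R -> R -> R) (psi : R -> R) (v : R) : R :=
  fine (\int[lebesgue_measure]_(u in I01) (W v u * psi u)%:E)%E.

Definition L2norm (f : R -> R) : \bar R :=
  poweR (\int[lebesgue_measure]_(x in I01) ((f x) ^+ 2)%:E)%E (2^-1).

Definition opnormL2 (T : (R -> R) -> (R -> R)) : \bar R :=
  ereal_sup [set L2norm (T psi) | psi in
    [set psi : R -> R | measurable_fun I01 psi /\ (L2norm psi <= 1)%E]].

Definition opsub (T1 T2 : (R -> R) -> (R -> R)) : (R -> R) -> (R -> R) :=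
  fun psi v => T1 psi v - T2 psi v.

(* h in C^1([-G,G]) with derivative h' (one-sided at the endpoints),
   h' Lipschitz on [-G,G]. *)
Definition C1_lipderiv (G : R) (h : R -> R) : Prop :=
  exists h' : R -> R,
    (forall x, x \in `[- G, G] ->
       (fun t => (h (x + t) - h x) / t)
         @ (within [set t | t != 0 /\ x + t \in `[- G, G]] (nbhs (0 : R)))
         --> h' x)
    /\ exists L : R, forall x y, x \in `[- G, G] -> y \in `[- G, G] ->
         `|h' x - h' y| <= L * `|x - y|.

End GraphonDefs.

(* Main.v *)
Require Import Defs.
From HB Require Import structures.
From mathcomp Require Import all_boot all_order all_algebra perm.
From mathcomp Require Import all_classical all_reals all_analysis.
From mathcomp Require Import complex.
From mathcomp Require Import measurable_realfun ring lra.
Import Order.TTheory GRing.Theory Num.Theory numFieldNormedType.Exports.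
Local Open Scope classical_set_scope.
Local Open Scope ring_scope.

(** After refining both partitions of [0, 1] to a common one, the operators
[T_W] become symmetric matrices [S1], [S2] with spectrum in [[-G, G]], and, as
[h 0 = 0], the operator of [n h(D)] becomes [h S]: the claim is that [h] is
operator Lipschitz. In eigenbases of [S1] and [S2], [h S1 - h S2] is the Schur
product of [S1 - S2] with the divided difference [k x y] of [h]. Since [h'] is
Lipschitz, so is [k x] uniformly in [x], and writing [k x y] as
[k x (-G) + \int_(-G)^y (k x)' s ds] exhibits it as the scalar product of two
bounded families of vectors, one depending on [x] and the other on [y]; such a
kernel is a bounded Schur multiplier. *)

(** * Spectral theorem for real symmetric matrices *)

Lemma dotv_ge0 {R : realType} {n} (w : 'rV[R]_n) : 0 <= (w *m w^T) 0 0.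
Proof. by rewrite mxE sumr_ge0// => i _; rewrite mxE -expr2 sqr_ge0. Qed.

Lemma dotv_eq0 {R : realType} {n} (w : 'rV[R]_n) : ((w *m w^T) 0 0 == 0) = (w == 0).
Proof.
apply/eqP/eqP => [|->]; last by rewrite mul0mx mxE.
rewrite mxE => /eqP; rewrite psumr_eq0 => [/allP w0|i _]; last first.
  by rewrite mxE -expr2 sqr_ge0.
apply/rowP => i; have := w0 i; rewrite mem_index_enum => /(_ isT).
by rewrite !mxE /= mulf_eq0 orbb => /eqP.
Qed.

(* Householder reflection; at [w = 0] the convention [2 / 0 = 0] makes it the identity. *)
Definition reflmx {R : realType} {n} (w : 'rV[R]_n) : 'M[R]_n :=
  1%:M - (2 / (w *m w^T) 0 0) *: (w^T *m w).

Lemma reflmx_sym {R : realType} {n} (w : 'rV[R]_n) : (reflmx w)^T = reflmx w.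
Proof. by rewrite /reflmx linearB/= trmx1 linearZ/= trmx_mul trmxK. Qed.

Lemma reflmxK {R : realType} {n} (w : 'rV[R]_n) : reflmx w *m reflmx w = 1%:M.
Proof.
have [->|w0] := eqVneq w 0.
  by rewrite /reflmx mulmx0 scaler0 subr0 mulmx1.
rewrite /reflmx; set s := (w *m w^T) 0 0.
have s0 : s != 0 by rewrite dotv_eq0.
have ww : w *m w^T = s%:M by rewrite [LHS]mx11_scalar.
have -> : (2 / s *: (w^T *m w)) = (2 / s) *: w^T *m w by rewrite scalemxAl.
set x := (2 / s) *: w^T.
have xx : x *m w *m (x *m w) = 2 *: (x *m w).
  have wx : w *m x = 2%:M.
    by rewrite /x -scalemxAr ww -mul_scalar_mx -scalar_mxM divfK.
  by rewrite mulmxA -(mulmxA x w x) wx mul_mx_scalar -scalemxAl.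
rewrite mulmxBl mul1mx mulmxBr mulmx1 xx scaler_nat mulr2n.
by rewrite opprB addrK subrK.
Qed.

(** For unit vectors, twice the scalar product of [v] and [v - e] equals the squared norm of
    [v - e], so the reflection subtracts exactly [v - e] from [v]. *)
Lemma unit_reflmx {R : realType} {n} (v e : 'rV[R]_n) :
  v *m v^T = 1%:M -> e *m e^T = 1%:M -> v *m reflmx (v - e) = e.
Proof.
move=> v1 e1.
have [/eqP|w0] := eqVneq (v - e) 0.
  by rewrite subr_eq0 => /eqP ->; rewrite subrr /reflmx mulmx0 scaler0 subr0 mulmx1.
rewrite /reflmx; set s := ((v - e) *m (v - e)^T) 0 0.
have s0 : s != 0 by rewrite dotv_eq0.
have ve : e *m v^T = v *m e^T.
  by rewrite -[LHS]trmxK trmx_mul trmxK [LHS]mx11_scalar [RHS]mx11_scalar mxE.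
have sE : s%:M = 2 *: (v *m (v - e)^T) :> 'M[R]_1.
  rewrite -[LHS]mx11_scalar linearB/= mulmxBl !mulmxBr v1 e1 ve.
  by rewrite scaler_nat mulr2n opprB addrC.
rewrite mulmxBr mulmx1 -scalemxAr mulmxA scalemxAl.

have -> : 2 / s *: (v *m (v - e)^T) = 1%:M.
  by rewrite mulrC -scalerA -sE -mul_scalar_mx -scalar_mxM mulVf.
by rewrite mul1mx opprB addrC subrK.
Qed.

(** Read over the complex numbers, [D] is hermitian, so the complex spectral theorem supplies an
    eigenvalue and shows that it is real; what remains is to find an eigenvector with real
    entries. *)
Lemma symmx_eigenvector {R : realType} {n} (D : 'M[R]_n.+1) : symmx D ->
  exists (v : 'rV[R]_n.+1) (a : R), v *m v^T = 1%:M /\ v *m D = a *: v.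
Proof.
move=> Dsym; set D' := map_mx (real_complex R) D.
have D'herm : D' \is hermsymmx.
  apply: realsym_hermsym.
    apply/is_hermitianmxP; rewrite expr0 scale1r map_mx_id//.
    by rewrite /D' map_trmx Dsym.
  by apply/mxOverP => i j; rewrite mxE; apply/complex_realP; exists (D i j).
have := hermitian_spectral_diag_real D'herm.
move=> /mxOverP /(_ 0 0) /complex_realP[a aE].
have /orthomx_spectralP DE := hermitian_normalmx D'herm.
have : eigenvalue D' (a%:C)%C.
  apply/eigenvalueP; exists (row 0 (spectralmx D')).
    rewrite -row_mul [X in _ *m X]DE !mulmxA mulmxV ?spectral_unit// mul1mx.
    by rewrite row_mul row_diag_mx aE -scalemxAl -rowE.
  apply/eqP => r0; have := congr1 (mulmx^~ (invmx (spectralmx D'))) r0.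
  rewrite -row_mul mulmxV ?spectral_unit// mul0mx => /rowP/(_ 0)/eqP.
  by rewrite !mxE eqxx oner_eq0.
(* The characteristic polynomial of [D'] is the image of that of [D], so the real number [a] is a
   root of the latter and has an eigenvector over [R]. *)
rewrite eigenvalue_root_char -map_char_poly fmorph_root -eigenvalue_root_char.
move=> /eigenvalueP[v vD v0].
have := dotv_ge0 v; rewrite le0r dotv_eq0 (negPf v0)/=; set s := _ 0 0 => s0.
exists ((Num.sqrt s)^-1 *: v), a; split; last first.
  by rewrite -scalemxAl vD scalerA mulrC -scalerA.
rewrite linearZ/= -scalemxAl -scalemxAr scalerA [v *m _]mx11_scalar -/s.
rewrite -mul_scalar_mx -scalar_mxM -expr2 exprVn sqr_sqrtr ?ltW//.
by rewrite mulVf// gt_eqF.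
Qed.

(** Deflation: conjugating by the reflection that exchanges a unit eigenvector with the first basis
    vector splits off a one-by-one block, and the induction treats the lower right block. *)
Lemma symmx_diagonalizable {R : realType} {n} (D : 'M[R]_n) : symmx D ->
  exists (U : 'M[R]_n) (d : 'rV[R]_n),
    [/\ U^T *m U = 1%:M, U *m U^T = 1%:M & D = U^T *m diag_mx d *m U].
Proof.
elim: n D => [|n IH] D Dsym.
  by exists 1%:M, 0; split; apply/matrixP => -[].
have [v [a [v1 vD]]] := symmx_eigenvector D Dsym.
pose e : 'rV[R]_n.+1 := delta_mx 0 0.
have e1 : e *m e^T = 1%:M.
  by rewrite /e trmx_delta mul_delta_mx [LHS]mx11_scalar mxE.
set Q := reflmx (v - e).
have vQ : v *m Q = e by exact: unit_reflmx.
have eQ : e *m Q = v by rewrite -vQ -mulmxA reflmxK mulmx1.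
(* The conjugate is retyped at size [1 + n], as the block operations require, and made opaque. *)
have [E ED] : {E : 'M[R]_(1 + n) | E = Q *m D *m Q} by exists (Q *m D *m Q).
have Esym : E^T = E by rewrite ED !trmx_mul reflmx_sym Dsym mulmxA.
have eE : e *m E = a *: e by rewrite ED !mulmxA eQ vD -scalemxAl vQ.
have E0 j : E 0 j = (a *: e) 0 j by rewrite -eE /e -rowE mxE.
have Eul : ulsubmx E = a%:M.
  by apply/matrixP => i j; rewrite !ord1 !mxE lshift0 E0 !mxE !eqxx mulr1.
have Eur : ursubmx E = 0.
  apply/matrixP => i j; rewrite !ord1 !mxE lshift0 E0 !mxE/=.
  by rewrite mulr0.
have Edl : dlsubmx E = 0 by rewrite -[E]Esym -trmx_ursub Eur trmx0.
have [|U' [d' [U1 U2 DE]]] := IH (drsubmx E).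
  by rewrite /symmx trmx_drsub Esym.
have EE : E = block_mx a%:M 0 0 (U'^T *m diag_mx d' *m U').
  by rewrite -DE -[LHS]submxK Eul Eur Edl.
pose V : 'M[R]_(1 + n) := block_mx 1%:M 0 0 U'.
have VT : V^T = block_mx 1%:M 0 0 U'^T by rewrite tr_block_mx trmx1 !trmx0.
have V1 : V^T *m V = 1%:M.
  rewrite VT mulmx_block !mulmx0 !mul0mx !mulmx1 U1 !addr0 !add0r.
  by rewrite -scalar_mx_block.
have V2 : V *m V^T = 1%:M.
  rewrite VT mulmx_block !mulmx0 !mul0mx !mulmx1 U2 !addr0 !add0r.
  by rewrite -scalar_mx_block.
have QQ : Q *m Q = 1%:M := reflmxK _.
have QT : Q^T = Q := reflmx_sym _.
exists (V *m Q), (row_mx a%:M d'); split.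
- by rewrite trmx_mul QT mulmxA -(mulmxA Q) V1 mulmx1.
- by rewrite trmx_mul QT mulmxA -(mulmxA V) QQ mulmx1.
have VV : V^T *m diag_mx (row_mx a%:M d' : 'rV_(1 + n)) *m V = E.
  rewrite VT diag_mx_row !mulmx_block !mulmx0 !mul0mx !addr0 !add0r !mulmx1 !mul1mx.
  rewrite ?mulmx0 ?mul0mx ?add0r EE; congr block_mx.
  by apply/matrixP => i j; rewrite !ord1 !mxE !eqxx !mulr1n.
rewrite trmx_mul QT !mulmxA -2!(mulmxA Q) VV ED !mulmxA QQ mul1mx.
by rewrite -mulmxA QQ mulmx1.
Qed.

(** * Schur multipliers *)

Lemma cauchy_schwarz_sum {R : realType} {I : finType} (p q : I -> R) :
  (\sum_i p i * q i) ^+ 2 <= (\sum_i p i ^+ 2) * (\sum_i q i ^+ 2).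
Proof.
set S := \sum_i p i * q i; set A := \sum_i p i ^+ 2; set B := \sum_i q i ^+ 2.
have A_ge0 : 0 <= A by rewrite sumr_ge0// => i _; rewrite sqr_ge0.
have [A0|A_neq0] := eqVneq A 0.
  have p0 i : p i = 0.
    apply/eqP; rewrite -sqrf_eq0; apply/eqP.
    have /eqP := A0; rewrite /A psumr_eq0 => [/allP/(_ i)|j _]; last exact: sqr_ge0.
    by rewrite mem_index_enum => /(_ isT)/eqP.
  by rewrite A0 mul0r /S big1 ?expr0n// => i _; rewrite p0 mul0r.
have A_gt0 : 0 < A by rewrite lt0r A_neq0.
(* Up to the factor [A], this is the squared norm of the component of [q] orthogonal to [p]. *)
have : 0 <= \sum_i (A * q i - S * p i) ^+ 2.
  by rewrite sumr_ge0// => i _; rewrite sqr_ge0.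
have -> : \sum_i (A * q i - S * p i) ^+ 2 = A * (A * B - S ^+ 2).
  rewrite (eq_bigr (fun i => A ^+ 2 * q i ^+ 2 + (- 2 * A * S) * (p i * q i)
                             + S ^+ 2 * p i ^+ 2)); last by move=> i _; ring.
  by rewrite !big_split/= -!mulr_sumr -/A -/B -/S; ring.
by rewrite pmulr_rge0// subr_ge0.
Qed.

Definition nsq {R : realType} {n} (x : 'cV[R]_n) : R := \sum_i x i 0 ^+ 2.

Lemma nsq_ge0 {R : realType} {n} (x : 'cV[R]_n) : 0 <= nsq x.
Proof. by rewrite sumr_ge0// => i _; rewrite sqr_ge0. Qed.

Lemma nsqE {R : realType} {n} (x : 'cV[R]_n) : nsq x = (x^T *m x) 0 0.
Proof. by rewrite mxE; apply: eq_bigr => i _; rewrite mxE expr2. Qed.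

Lemma nsq_eq0 {R : realType} {n} (x : 'cV[R]_n) : nsq x = 0 -> x = 0.
Proof.
move=> /eqP; rewrite psumr_eq0 => [/allP x0|i _]; last exact: sqr_ge0.
apply/colP => i; have := x0 i; rewrite mem_index_enum => /(_ isT).
by rewrite sqrf_eq0 mxE => /eqP.
Qed.

Lemma nsqZ {R : realType} {n} (a : R) (x : 'cV[R]_n) : nsq (a *: x) = a ^+ 2 * nsq x.
Proof. by rewrite /nsq mulr_sumr; apply: eq_bigr => i _; rewrite mxE exprMn. Qed.

Lemma cauchy_schwarz_mx {R : realType} {n} (x y : 'cV[R]_n) :
  ((x^T *m y) 0 0) ^+ 2 <= nsq x * nsq y.
Proof.
rewrite mxE; apply: le_trans (cauchy_schwarz_sum (fun i => x i 0) (fun i => y i 0)).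
by under eq_bigr => i _ do rewrite mxE.
Qed.

Lemma nsq_isometry {R : realType} {m n} (X : 'M[R]_(m, n)) (x : 'cV[R]_n) :
  X^T *m X = 1%:M -> nsq (X *m x) = nsq x.
Proof.
by move=> X1; rewrite !nsqE trmx_mul mulmxA -(mulmxA _ X^T) X1 mulmx1.
Qed.

(** With [w = X^T u], the squared norm of [w] is the scalar product of [u] and [X w]. Cauchy-Schwarz
    applies, [X w] has the norm of [w], and one factor cancels. *)
Lemma nsq_coisometry_le {R : realType} {m n} (X : 'M[R]_(m, n)) (u : 'cV[R]_m) :
  X^T *m X = 1%:M -> nsq (X^T *m u) <= nsq u.
Proof.
move=> X1; set w := X^T *m u.
have [->|w0] := eqVneq (nsq w) 0; first exact: nsq_ge0.
have w_gt0 : 0 < nsq w by rewrite lt0r w0 nsq_ge0.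
have : nsq w ^+ 2 <= nsq u * nsq w.
  rewrite -(nsq_isometry X w X1) in w_gt0 *.
  rewrite {1}(nsq_isometry X w X1) {1}nsqE {1}/w trmx_mul trmxK -mulmxA.
  exact: cauchy_schwarz_mx.
by rewrite expr2 ler_pM2r.
Qed.

(** The outer [X^T] contracts and the inner [X] preserves norms, so only the diagonal factors count;
    for these the sum over [l] can be taken coordinate by coordinate. *)
Lemma sum_nsq_frame_le {R : realType} {m n r} (X : 'M[R]_(m, n)) (a : 'I_r -> 'rV[R]_m)
    (alpha : R) (x : 'cV[R]_n) :
  X^T *m X = 1%:M -> (forall i, \sum_l a l 0 i ^+ 2 <= alpha) ->
  \sum_l nsq (X^T *m diag_mx (a l) *m X *m x) <= alpha * nsq x.
Proof.
move=> X1 ha; rewrite -(nsq_isometry X x X1).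
apply: (@le_trans _ _ (\sum_l nsq (diag_mx (a l) *m (X *m x)))).
  by apply: ler_sum => l _; rewrite -!mulmxA; apply: nsq_coisometry_le.
rewrite /nsq exchange_big/= mulr_sumr; apply: ler_sum => i _.
rewrite (eq_bigr (fun l => a l 0 i ^+ 2 * (X *m x) i 0 ^+ 2)) => [|l _].
  by rewrite -mulr_suml ler_wpM2r ?sqr_ge0.
by rewrite mul_diag_mx mxE exprMn.
Qed.

(** Duality: the image [g] of [x] is paired with itself, each [A l] is moved to the other side, and
    Cauchy-Schwarz is used first for each [l] and then over [l]. Cancelling one factor [nsq g]
    leaves the bound. *)
Lemma nsq_sum_sandwich_le {R : realType} {n r} (A B : 'I_r -> 'M[R]_n) (D : 'M[R]_n)
    (alpha beta c : R) :
  (forall x, nsq (D *m x) <= c * nsq x) ->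
  (forall x, \sum_l nsq ((A l)^T *m x) <= alpha * nsq x) ->
  (forall x, \sum_l nsq (B l *m x) <= beta * nsq x) ->
  0 <= alpha -> 0 <= beta -> 0 <= c ->
  forall x, nsq ((\sum_l A l *m D *m B l) *m x) <= alpha * beta * c * nsq x.
Proof.
move=> hD hA hB a0 b0 c0 x; set g := _ *m x.
have [g0|g_neq0] := eqVneq (nsq g) 0.
  by rewrite g0 !mulr_ge0// nsq_ge0.
have g_gt0 : 0 < nsq g by rewrite lt0r g_neq0 nsq_ge0.
pose u l := Num.sqrt (nsq ((A l)^T *m g)); pose w l := Num.sqrt (nsq (D *m (B l *m x))).
have gE : nsq g <= \sum_l u l * w l.
  have -> : nsq g = \sum_l (((A l)^T *m g)^T *m (D *m (B l *m x))) 0 0.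
    rewrite nsqE {2}/g mulmx_suml mulmx_sumr summxE; apply: eq_bigr => l _.
    by rewrite (trmx_mul (A l)^T) trmxK !mulmxA.
  apply: ler_sum => l _; apply: le_trans (ler_norm _) _.
  rewrite -sqrtr_sqr /u /w -sqrtrM ?nsq_ge0// ler_wsqrtr//.
  exact: cauchy_schwarz_mx.
have : nsq g ^+ 2 <= (alpha * nsq g) * (c * (beta * nsq x)).
  apply: (@le_trans _ _ ((\sum_l u l * w l) ^+ 2)).
    by rewrite ler_pXn2r// ?nnegrE ?(ltW g_gt0)// (le_trans (ltW g_gt0)).
  apply: le_trans (cauchy_schwarz_sum _ _) _.
  apply: ler_pM => //; try by rewrite sumr_ge0// => l _; rewrite sqr_ge0.
    by under eq_bigr => l _ do rewrite sqr_sqrtr ?nsq_ge0//.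
  under eq_bigr => l _ do rewrite sqr_sqrtr ?nsq_ge0//.
  apply: le_trans (ler_wpM2l c0 (hB x)); rewrite mulr_sumr.
  by apply: ler_sum => l _; apply: hD.
have -> : alpha * nsq g * (c * (beta * nsq x)) = nsq g * (alpha * beta * c * nsq x) by ring.
by rewrite expr2 ler_pM2l.
Qed.

(* A Schur multiplier [k i j = \sum_l a l i * b l j] acts as a sum of two-sided products. *)
Lemma divided_difference_sandwich {R : realType} {m1 m2 n r}
    (X1 : 'M[R]_(m1, n)) (X2 : 'M[R]_(m2, n)) (S1 S2 : 'M[R]_n)
    (d hd : 'rV[R]_m1) (e he : 'rV[R]_m2)
    (a : 'I_r -> 'rV[R]_m1) (b : 'I_r -> 'rV[R]_m2) :
  X1^T *m X1 = 1%:M -> X2^T *m X2 = 1%:M ->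
  X1 *m S1 = diag_mx d *m X1 -> S2 *m X2^T = X2^T *m diag_mx e ->
  (forall i j, hd 0 i - he 0 j = (\sum_l a l 0 i * b l 0 j) * (d 0 i - e 0 j)) ->
  X1^T *m diag_mx hd *m X1 - X2^T *m diag_mx he *m X2 =
  \sum_l (X1^T *m diag_mx (a l) *m X1) *m (S1 - S2) *m (X2^T *m diag_mx (b l) *m X2).
Proof.
(* [Z] compares the two frames. Between them, a difference of diagonal actions multiplies the entry
   [i j] of [Z] by the difference of the eigenvalues, so [hk] can be applied entrywise. *)
move=> X11 X21 XS SX hk; set Z := X1 *m X2^T.
have -> : X1^T *m diag_mx hd *m X1 - X2^T *m diag_mx he *m X2
        = X1^T *m (diag_mx hd *m Z - Z *m diag_mx he) *m X2.
  rewrite mulmxBr mulmxBl /Z; congr (_ - _).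
    by rewrite -!mulmxA X21 mulmx1.
  by rewrite !mulmxA X11 mul1mx.
have -> : diag_mx hd *m Z - Z *m diag_mx he
        = \sum_l diag_mx (a l) *m (diag_mx d *m Z - Z *m diag_mx e) *m diag_mx (b l).
  apply/matrixP => i j.
  have commE (M : 'M[R]_(m1, m2)) (p : 'rV[R]_m1) (q : 'rV[R]_m2) :
      (diag_mx p *m M - M *m diag_mx q) i j = (p 0 i - q 0 j) * M i j.
    by rewrite mul_diag_mx mul_mx_diag !mxE (mulrC (M i j)) mulrBl.
  have sandE (M : 'M[R]_(m1, m2)) (p : 'rV[R]_m1) (q : 'rV[R]_m2) :
      (diag_mx p *m M *m diag_mx q) i j = p 0 i * M i j * q 0 j.
    by rewrite mul_mx_diag mul_diag_mx !mxE.
  rewrite commE hk -mulrA mulr_suml summxE; apply: eq_bigr => l _.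
  by rewrite sandE commE mulrAC.
rewrite mulmx_sumr mulmx_suml; apply: eq_bigr => l _.
have -> : diag_mx d *m Z - Z *m diag_mx e = X1 *m (S1 - S2) *m X2^T.
  by rewrite mulmxBr mulmxBl XS -(mulmxA X1 S2) SX !mulmxA.
by rewrite !mulmxA.
Qed.

(* Completes an orthonormal family (the rows of [X]) to a tight frame; the added rows span
   the kernel of [X^T *m diag_mx d *m X], whence the padding of [d] by zeros. *)
Lemma tight_frame_completion {R : realType} {m n} (X : 'M[R]_(m, n)) :
  X *m X^T = 1%:M ->
  exists Y : 'M[R]_(m + n, n), Y^T *m Y = 1%:M /\
    forall d : 'rV[R]_m,
      Y *m (X^T *m diag_mx d *m X) = diag_mx (row_mx d 0) *m Y /\
      X^T *m diag_mx d *m X = Y^T *m diag_mx (row_mx d 0) *m Y.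
Proof.
move=> X1; pose P := 1%:M - X^T *m X.
have PT : P^T = P by rewrite /P linearB/= trmx1 trmx_mul trmxK.
have XP : X *m P = 0 by rewrite /P mulmxBr mulmx1 mulmxA X1 mul1mx subrr.
have PXT : P *m X^T = 0 by rewrite -[LHS]trmxK trmx_mul trmxK PT XP trmx0.
have Y1 : (col_mx X P)^T *m col_mx X P = 1%:M.
  rewrite tr_col_mx mul_row_col PT {2}/P mulmxBr mulmx1 mulmxA PXT mul0mx subr0.
  by rewrite addrC subrK.
exists (col_mx X P); split=> // d.
have YS : col_mx X P *m (X^T *m diag_mx d *m X) = diag_mx (row_mx d 0) *m col_mx X P.
  rewrite diag_mx_row mul_block_col mul_col_mx !mul0mx addr0 add0r !mulmxA X1 mul1mx.
  by rewrite PXT !mul0mx linear0 mul0mx.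
by split=> //; rewrite -[RHS]mulmxA -YS mulmxA Y1 mul1mx.
Qed.

(** * Factorization of Lipschitz kernels *)

(** Provides the grid of a discrete integration. Prepending [- G] to the sorted values gives a base
    point and keeps the list nonempty even for [m = 0]. *)
Lemma nondecreasing_enumeration {R : realType} {m} (e : 'I_m -> R) (G : R) :
  0 <= G -> (forall j, `|e j| <= G) ->
  exists (r : nat) (t : nat -> R) (p : 'I_m -> nat),
    [/\ forall l, (l <= r)%N -> `|t l| <= G,
        forall l, (l < r)%N -> t l <= t l.+1 &
        forall j, (p j <= r)%N /\ t (p j) = e j].
Proof.
move=> G0 eG; pose s := - G :: sort <=%R (codom e).
have s_mem x : x \in s -> `|x| <= G.
  rewrite in_cons mem_sort => /orP[/eqP ->|/codomP[j ->]//].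
  by rewrite normrN ger0_norm.
have s_sorted : sorted <=%R s.
  rewrite /= path_min_sorted ?sort_le_sorted//; apply/allP => x.
  rewrite mem_sort => /codomP[j ->].
  by have := eG j; rewrite ler_norml => /andP[].
exists (size s).-1, (nth 0 s), (fun j => index (e j) s); split.
- by move=> l lr; apply/s_mem/mem_nth.
- by move=> l lr; apply: (sortedP 0 s_sorted).
- move=> j; have ej : e j \in s by rewrite in_cons mem_sort codom_f orbT.
  by rewrite nth_index//; split=> //; rewrite -ltnS prednK// index_mem.
Qed.

(* Discrete form of [k x y = k x (-G) + \int_(-G)^y d/ds (k x s) ds]: the kernel is a scalar
   product of [(k x (-G), d/ds (k x s))] and [(1, 1_(s <= y))]. *)
Lemma lipschitz_kernel_factor {R : realType} {m1 m2} (k : R -> R -> R) (G K L : R)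
    (d : 'rV[R]_m1) (e : 'rV[R]_m2) :
  0 <= G -> 0 <= L ->
  (forall x y, `|x| <= G -> `|y| <= G -> `|k x y| <= K) ->
  (forall x y z, `|x| <= G -> `|y| <= G -> `|z| <= G ->
     `|k x y - k x z| <= L * `|y - z|) ->
  (forall i, `|d 0 i| <= G) -> (forall j, `|e 0 j| <= G) ->
  exists (r : nat) (a : 'I_r -> 'rV[R]_m1) (b : 'I_r -> 'rV[R]_m2),
    [/\ forall i j, k (d 0 i) (e 0 j) = \sum_l a l 0 i * b l 0 j,
        forall i, \sum_l a l 0 i ^+ 2 <= K ^+ 2 + L ^+ 2 * (G *+ 2) &
        forall j, \sum_l b l 0 j ^+ 2 <= 1 + G *+ 2].
Proof.
move=> G0 L0 kK kL dG eG.
have [r [t [p [tG tS tp]]]] := nondecreasing_enumeration (fun j => e 0 j) G G0 eG.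
pose delta l := t l.+1 - t l.
have delta0 l : (l < r)%N -> 0 <= delta l by move=> lr; rewrite subr_ge0 tS.
have sum_delta : \sum_(l < r) delta l <= G *+ 2.
  rewrite -(big_mkord xpredT delta) telescope_sumr// mulr2n.
  have := tG _ (leqnn r); have := tG 0 (leq0n r).
  by rewrite !ler_norml; move=> /andP[? _] /andP[_ ?]; lra.
pose q x l := k x (t l.+1) - k x (t l).
have q_le x l : `|x| <= G -> (l < r)%N -> `|q x l| <= L * delta l.
  move=> xG lr; apply: le_trans (kL _ _ _ xG (tG _ lr) (tG _ (ltnW lr))) _.
  by rewrite ger0_norm// delta0.
(* Index 0 carries the value at the base point, and index [l'.+1] the increment over the step [l'].
   Splitting that increment as [q / sqrt delta] times [sqrt delta] balances the two families: the
   squares are at most [L ^+ 2 * delta] and [delta], and the steps add up to at most [G *+ 2]. *)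
exists r.+1,
  (fun l => \row_i if nat_of_ord l is l'.+1
                   then q (d 0 i) l' / Num.sqrt (delta l') else k (d 0 i) (t 0)),
  (fun l => \row_j if nat_of_ord l is l'.+1
                   then if (l' < p j)%N then Num.sqrt (delta l') else 0 else 1); split.
- move=> i j; rewrite big_ord_recl !mxE/= mulr1.
  have [pr <-] := tp j.
  have -> : \sum_(l < r) (\row_i0 (q (d 0 i0) l / Num.sqrt (delta l))) 0 i *
      (\row_j0 (if (l < p j0)%N then Num.sqrt (delta l) else 0)) 0 j
    = \sum_(l < r | (l < p j)%N) q (d 0 i) l.
    rewrite [RHS]big_mkcond/=; apply: eq_bigr => l _; rewrite !mxE.
    case: ifP => _; last by rewrite mulr0.
    (* Repeated values give steps of length 0, where the quotient is 0 by convention; the Lipschitz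
       bound makes the increment vanish there as well. *)
    have [d0|d0] := eqVneq (delta l) 0.
      have := q_le _ _ (dG i) (ltn_ord l).
      by rewrite d0 mulr0 normr_le0 => /eqP ->; rewrite !mul0r.
    by rewrite divfK// gt_eqF// sqrtr_gt0 lt0r d0 delta0.
  rewrite -(big_ord_widen _ (q (d 0 i)) pr) -(big_mkord xpredT).
  by rewrite telescope_sumr// addrC subrK.
- move=> i; rewrite big_ord_recl !mxE/= lerD//.
    rewrite -[leLHS]real_normK ?num_real// ler_pXn2r ?nnegrE// ?kK// ?tG//.
    exact: le_trans (kK _ _ (dG i) (tG 0 (leq0n r))).
  apply: (@le_trans _ _ (\sum_(l < r) L ^+ 2 * delta l)); last first.
    by rewrite -mulr_sumr ler_wpM2l ?sqr_ge0.
  apply: ler_sum => l _; have l0 := delta0 _ (ltn_ord l).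
  rewrite mxE exprMn exprVn sqr_sqrtr//.
  have [d0|d0] := eqVneq (delta l) 0; first by rewrite d0 invr0 !mulr0.
  rewrite ler_pdivrMr; last by rewrite lt0r d0.
  rewrite -mulrA -expr2 -exprMn -[leLHS]real_normK ?num_real//.
  rewrite ler_pXn2r ?nnegrE ?mulr_ge0//.
  exact: (q_le _ _ (dG i) (ltn_ord l)).
- move=> j; rewrite big_ord_recl !mxE/= expr1n lerD2l.
  apply: le_trans sum_delta; apply: ler_sum => l _; have l0 := delta0 _ (ltn_ord l).
  by rewrite mxE; case: ifP => _; rewrite ?sqr_sqrtr ?expr0n.
Qed.

(** * Divided differences *)

Lemma is_derive1_eps {R : realType} (f : R -> R) (t l : R) :
  (forall eps : R, 0 < eps -> exists2 delta : R, 0 < delta &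
     forall s : R, `|s| < delta -> `|f (t + s) - f t - l * s| <= eps * `|s|) ->
  is_derive t 1 f l.
Proof.
move=> fl.
have dl : (fun s => s^-1 *: (f (s *: 1 + t) - f t)) @ 0^' --> l.
  apply/cvgrPdist_le => eps eps0; have [delta delta0 fd] := fl _ eps0.
  rewrite near_withinE; exists delta => //= s /=; rewrite sub0r normrN => sd s0.
  have := fd _ sd; rewrite -ler_pdivrMr ?normr_gt0// -normfV -normrM.
  rewrite [s *: 1]mulr1 (addrC s); congr (_ <= _); rewrite -normrN; congr `|_|.
  by rewrite /GRing.scale/=; field.
by apply: DeriveDef; [apply/cvg_ex; exists l | apply/cvg_lim].
Qed.

Section DividedDifference.
Context {R : realType} (G L : R) (h h' : R -> R).
Hypothesis h_derive : forall x : R, x \in `[- G, G] ->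
  (fun t => (h (x + t) - h x) / t)
    @ (within [set t | t != 0 /\ x + t \in `[- G, G]] (nbhs (0 : R))) --> h' x.
Hypothesis h'_lip : forall x y : R, x \in `[- G, G] -> y \in `[- G, G] ->
  `|h' x - h' y| <= L * `|x - y|.

(** The value on the diagonal is the limit of the quotient, so that the Lipschitz bound in the
    second argument extends across the diagonal. *)
Definition divided_difference (x y : R) : R :=
  if x == y then h' x else (h x - h y) / (x - y).

Lemma divided_differenceM (x y : R) :
  h x - h y = divided_difference x y * (x - y).
Proof.
rewrite /divided_difference; case: eqVneq => [->|xy]; first by rewrite !subrr mulr0.
by rewrite divfK// subr_eq0.
Qed.

(** Multiplying out the difference quotient includes [t = 0] and treats the endpoints, where only
    one-sided increments are allowed, like the interior points. *)
Let taylor_eps (x : R) : x \in `[- G, G] -> forall eps : R, 0 < eps ->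
  exists2 delta : R, 0 < delta &
  forall t : R, `|t| < delta -> x + t \in `[- G, G] -> `|h (x + t) - h x - h' x * t| <= eps * `|t|.
Proof.
move=> xI eps eps0; have /cvgrPdist_le/(_ _ eps0) := h_derive x xI.
rewrite near_withinE => -[delta /= delta0 hd]; exists delta => // t td tI.
have [->|t0] := eqVneq t 0; first by rewrite addr0 subrr mulr0 subrr normr0 mulr0.
have := hd t; rewrite /= sub0r normrN => /(_ td (conj t0 tI)).
rewrite -[X in _ -> _ <= X]mulrC -ler_pdivrMl ?normr_gt0// -normfV -normrM.
by congr (_ <= _); rewrite -normrN; congr `|_|; field.
Qed.

Let segmentP (x y t : R) : x \in `[- G, G] -> y \in `[- G, G] -> 0 <= t <= 1 ->
  x + t * (y - x) \in `[- G, G].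
Proof. by rewrite !in_itv/= => /andP[? ?] /andP[? ?] /andP[? ?]; apply/andP; split; nra. Qed.

Let continuous_segment (x y : R) : x \in `[- G, G] -> y \in `[- G, G] ->
  {within `[0, 1], continuous (fun t => h (x + t * (y - x)))}.
Proof.
move=> xI yI; apply/subspace_continuousP => t; rewrite /= in_itv/= => t01.
set z := x + t * (y - x); have zI : z \in `[- G, G] by exact: segmentP.
apply/cvgrPdist_lt => eps eps0; rewrite near_withinE.
have [delta delta0 hz] := taylor_eps z zI 1 ltr01.
(* The first-order estimate with error 1 bounds the increment of [h] by [1 + |h' z|] times that of
   its argument; the added 1 in each factor keeps the divisors positive. *)
pose K := (1 + `|h' z|) * (1 + `|y - x|).
have K_gt0 : 0 < K by rewrite mulr_gt0// ltr_pwDl.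
exists (Num.min (delta / (1 + `|y - x|)) (eps / K)) => /=.
  by rewrite lt_min !divr_gt0// ltr_pwDl.
move=> s /=; rewrite lt_min => /andP[ts1 ts2]; rewrite in_itv/= => s01.
rewrite distrC; have := hz ((s - t) * (y - x)).
have -> : z + (s - t) * (y - x) = x + s * (y - x) by rewrite /z; ring.
rewrite normrM (distrC s t) mul1r.
have yx0 : 0 <= `|y - x| by [].
move: ts1; rewrite ltr_pdivlMr ?ltr_pwDl// => ts1.
move: ts2; rewrite ltr_pdivlMr// => ts2.
have [ts0 h'0] : 0 <= `|t - s| /\ 0 <= `|h' z| by [].
have -> : `|t - s| * `|y - x| < delta by apply: le_lt_trans ts1; nra.
rewrite segmentP// => /(_ isT isT) hle.
apply: le_lt_trans ts2.
have := ler_normD (h (x + s * (y - x)) - h z - h' z * ((s - t) * (y - x)))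
                  (h' z * ((s - t) * (y - x))).
rewrite subrK !normrM (distrC s t) => /le_trans; apply.
apply: le_trans (lerD hle (lexx _)) _; rewrite /K; nra.
Qed.

Let is_derive_segment (x y t : R) : x \in `[- G, G] -> y \in `[- G, G] -> x != y ->
  t \in `]0, 1[ ->
  is_derive t 1 (fun t => h (x + t * (y - x)) / (y - x)) (h' (x + t * (y - x))).
Proof.
move=> xI yI xy; rewrite in_itv/= => /andP[t0 t1].
have w0 : y - x != 0 by rewrite subr_eq0 eq_sym.
apply: is_derive1_eps => eps eps0; set z := x + t * (y - x).
have zI : z \in `[- G, G] by apply: segmentP => //; rewrite !ltW.
have [delta delta0 hz] := taylor_eps z zI eps eps0.
(* The first bound makes the increment [s * (y - x)] shorter than [delta]; the other two keep
   [t + s] in the unit interval, hence the argument of [h] in its domain. *)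
exists (Num.min (delta / `|y - x|) (Num.min t (1 - t))).
  by rewrite !lt_min divr_gt0 ?normr_gt0//= t0 subr_gt0.
move=> s; rewrite !lt_min ltr_pdivlMr ?normr_gt0// -normrM => /and3P[sd st st1].
have := hz _ sd.
have -> : z + s * (y - x) = x + (t + s) * (y - x) by rewrite /z; ring.
have tsI : 0 <= t + s <= 1.
  by move: st st1; rewrite !ltr_norml => /andP[? ?] /andP[? ?]; apply/andP; split; lra.
rewrite segmentP// => /(_ isT); rewrite normrM [eps * _]mulrA -ler_pdivrMr ?normr_gt0//.
by rewrite -normfV -normrM; congr (_ <= _); congr `|_|; field.
Qed.

(* A primitive of [t |-> h' (x + t * (y - x))], whose increment over [0, 1] is the divided
   difference: the mean value theorem then replaces the integral representation. *)
Let primitive (x y t : R) : R :=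
  if x == y then h' x * t else h (x + t * (y - x)) / (y - x).

Let primitiveB (x y : R) : primitive x y 1 - primitive x y 0 = divided_difference x y.
Proof.
rewrite /primitive /divided_difference; case: eqVneq => [_|xy].
  by rewrite mulr1 mulr0 subr0.
rewrite mul1r mul0r addr0 [x + _]addrC subrK -mulrBl -[h x - h y]opprB -[x - y]opprB.
by rewrite invrN mulrNN.
Qed.

Let is_derive_primitive (x y t : R) : x \in `[- G, G] -> y \in `[- G, G] -> t \in `]0, 1[ ->
  is_derive t 1 (primitive x y) (h' (x + t * (y - x))).
Proof.
move=> xI yI tI; rewrite /primitive; case: eqVneq => [->|xy].
  rewrite subrr mulr0 addr0; apply: is_derive1_eps => eps eps0; exists 1 => // s _.
  by rewrite mulrDr [_ * t + _]addrC addrK subrr normr0 mulr_ge0// ltW.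
exact: is_derive_segment.
Qed.

Let continuous_primitive (x y : R) : x \in `[- G, G] -> y \in `[- G, G] ->
  {within `[0, 1], continuous (primitive x y)}.
Proof.
move=> xI yI t; rewrite /primitive; case: eqVneq => _.
  by apply: continuous_subspaceT => {}t; apply: cvgMr; exact: cvg_id.
by apply: cvgMl; exact: continuous_segment.
Qed.

(** The mean value theorem is applied to the difference of the two primitives, so that one point [c]
    serves both; the arguments of [h'] then differ by [c * (y - z)]. The absolute value of [L]
    appears because [L] comes without a sign. *)
Lemma divided_difference_lipschitz (x y z : R) :
  x \in `[- G, G] -> y \in `[- G, G] -> z \in `[- G, G] ->
  `|divided_difference x y - divided_difference x z| <= `|L| * `|y - z|.
Proof.
move=> xI yI zI.
have [t tI|t|c c01] := @MVT R (primitive x y \- primitive x z)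
  (fun t => h' (x + t * (y - x)) - h' (x + t * (z - x))) 0 1 ltr01.
- by apply: is_deriveB; exact: is_derive_primitive.
- by apply: cvgB; [exact: (continuous_primitive x y xI yI t) |
                   exact: (continuous_primitive x z xI zI t)].
rewrite subr0 mulr1 /= => gE.
have -> : divided_difference x y - divided_difference x z
    = h' (x + c * (y - x)) - h' (x + c * (z - x)).
  by rewrite -gE -!primitiveB; ring.
move: c01; rewrite in_itv/= => /andP[c0 c1].
have cI : 0 <= c <= 1 by rewrite !ltW.
apply: le_trans (h'_lip _ _ (segmentP _ _ _ xI yI cI) (segmentP _ _ _ xI zI cI)) _.
have -> : x + c * (y - x) - (x + c * (z - x)) = c * (y - z) by ring.
apply: le_trans (ler_wpM2r _ (ler_norm L)) _ => //.
by rewrite normrM ger0_norm ?(ltW c0)// ler_wpM2l// ler_piMl// ltW.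
Qed.

End DividedDifference.

Lemma C1_lipderiv_divided_difference {R : realType} (G : R) (h : R -> R) :
  0 <= G -> C1_lipderiv G h ->
  exists (k : R -> R -> R) (K L : R),
    [/\ 0 <= L, forall x y, h x - h y = k x y * (x - y),
        forall x y, `|x| <= G -> `|y| <= G -> `|k x y| <= K &
        forall x y z, `|x| <= G -> `|y| <= G -> `|z| <= G ->
          `|k x y - k x z| <= L * `|y - z|].
Proof.
move=> G0 [h' [h_derive [L h'_lip]]].
have inI x : `|x| <= G -> x \in `[- G, G] by rewrite ler_norml in_itv.
have k_lip x y z : `|x| <= G -> `|y| <= G -> `|z| <= G ->
    `|divided_difference h h' x y - divided_difference h h' x z| <= `|L| * `|y - z|.
  by move=> *; apply: (divided_difference_lipschitz G) => //; exact: inI.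
(* The first two terms bound [h' x], the diagonal value; the last bounds the change of the kernel
   from [x] to [y], two points at distance at most [G + G]. *)
exists (divided_difference h h'), (`|h' 0| + `|L| * G + `|L| * (G + G)), `|L|; split=> //.
  exact: divided_differenceM.
move=> x y xG yG; have := k_lip x y x xG yG xG.
rewrite {2}/divided_difference eqxx => kyx.
have h'x : `|h' x - h' 0| <= `|L| * G.
  apply: (le_trans (h'_lip x 0 (inI _ xG) (inI _ _))); first by rewrite normr0.
  rewrite subr0; apply: le_trans (ler_wpM2r _ (ler_norm L)) _ => //.
  by rewrite ler_wpM2l.
have yxG : `|L| * `|y - x| <= `|L| * (G + G).
  by rewrite ler_wpM2l// (le_trans (ler_normB _ _))// lerD.
have := ler_normD (divided_difference h h' x y - h' x) (h' x).
have := ler_normD (h' x - h' 0) (h' 0).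
rewrite !subrK; lra.
Qed.

(** * Operator Lipschitz estimate for symmetric matrices *)

(** The rows of [X1] and [X2] need not span the whole space, so both are completed to tight frames.
    The added directions get eigenvalue 0, which [h] fixes; the factored kernel then writes the
    difference of the images as a sum of two-sided products. The constant is chosen before the
    sizes. *)
Lemma lipschitz_calculus {R : realType} (G : R) (h : R -> R) :
  0 <= G -> C1_lipderiv G h -> h 0 = 0 ->
  exists C : R, 0 < C /\
    forall (m1 m2 n : nat) (X1 : 'M[R]_(m1, n)) (X2 : 'M[R]_(m2, n))
        (d : 'rV[R]_m1) (e : 'rV[R]_m2) (c : R),
      X1 *m X1^T = 1%:M -> X2 *m X2^T = 1%:M ->
      (forall i, `|d 0 i| <= G) -> (forall j, `|e 0 j| <= G) ->
      (forall x, nsq ((X1^T *m diag_mx d *m X1 - X2^T *m diag_mx e *m X2) *m x)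
                 <= c ^+ 2 * nsq x) ->
      forall x, nsq ((X1^T *m diag_mx (map_mx h d) *m X1
                      - X2^T *m diag_mx (map_mx h e) *m X2) *m x)
                <= (C * c) ^+ 2 * nsq x.
Proof.
move=> G0 hC1 h0.
have [k [K [L [L0 hk kK kL]]]] := C1_lipderiv_divided_difference G h G0 hC1.
pose alpha := K ^+ 2 + L ^+ 2 * (G *+ 2); pose beta := 1 + G *+ 2.
have alpha0 : 0 <= alpha by rewrite addr_ge0 ?sqr_ge0// mulr_ge0 ?sqr_ge0 ?mulrn_wge0.
have beta0 : 0 <= beta by rewrite addr_ge0 ?mulrn_wge0.
have ab0 : 0 <= alpha * beta by rewrite mulr_ge0.
(* The squared norm is bounded with the factor [alpha * beta], which is at most the square of
   [alpha * beta + 1]; this avoids a square root and is positive. *)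
exists (alpha * beta + 1); split; first by rewrite ltr_wpDl.
move=> m1 m2 n X1 X2 d e c X11 X21 dG eG hc x.
have [Y1 [Y11 YX1]] := tight_frame_completion X1 X11.
have [Y2 [Y21 YX2]] := tight_frame_completion X2 X21.
have hrow (m : nat) (f : 'rV[R]_m) :
    row_mx (map_mx h f) 0 = map_mx h (row_mx f (0 : 'rV[R]_n)).
  by rewrite map_row_mx; congr row_mx; apply/rowP => i; rewrite !mxE h0.
have rowG (m : nat) (f : 'rV[R]_m) : (forall i, `|f 0 i| <= G) ->
    forall i, `|row_mx f (0 : 'rV[R]_n) 0 i| <= G.
  by move=> fG i; rewrite mxE; case: splitP => j _ //; rewrite mxE normr0.
have [r [a [b [kE ha hb]]]] := lipschitz_kernel_factor k G K L
  (row_mx d 0) (row_mx e 0) G0 L0 kK kL (rowG _ d dG) (rowG _ e eG).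
have [YS1 _] := YX1 d; have [YS2 _] := YX2 e.
have SY2 : X2^T *m diag_mx e *m X2 *m Y2^T = Y2^T *m diag_mx (row_mx e 0).
  apply: trmx_inj; rewrite trmx_mul trmxK [RHS]trmx_mul trmxK tr_diag_mx -YS2.
  by rewrite !trmx_mul trmxK tr_diag_mx !mulmxA.
have [_ ->] := YX1 (map_mx h d); have [_ ->] := YX2 (map_mx h e).
rewrite !hrow (divided_difference_sandwich Y1 Y2 _ _ _ _ _ _ a b Y11 Y21 YS1 SY2); last first.
  by move=> i j; rewrite ![(map_mx h _) _ _]mxE hk kE.
apply: (@le_trans _ _ (alpha * beta * c ^+ 2 * nsq x)); last first.
  rewrite ler_wpM2r ?nsq_ge0// exprMn ler_wpM2r ?sqr_ge0//.
  by move: ab0; set t := alpha * beta => t0; nra.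
apply: nsq_sum_sandwich_le => //; try exact: sqr_ge0.
- move=> y; under eq_bigr => l _ do rewrite !trmx_mul trmxK tr_diag_mx mulmxA.
  exact: sum_nsq_frame_le.
- by move=> y; exact: sum_nsq_frame_le.
Qed.

(** * Functional calculus and eigenvalue bounds *)

(** The spectral theorem makes the set of candidates nonempty, so the choice in [fcalc] does not
    fall back on its default 0. *)
Lemma fcalcP {R : realType} (h : R -> R) {n} (D : 'M[R]_n) :
  symmx D -> fcalc_of h D (fcalc h D).
Proof.
move=> /symmx_diagonalizable[U [d [U1 U2 DE]]].
apply: (@xgetPex _ 0 [set F | fcalc_of h D F]).
by exists (U^T *m diag_mx (map_mx h d) *m U), U, d.
Qed.

Lemma symmx_permmx {R : realType} {n} (p : {perm 'I_n}) (D : 'M[R]_n) :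
  symmx D -> symmx (permmx p D).
Proof.
by move=> /matrixP Dsym; apply/matrixP => i j; rewrite !mxE -[RHS]Dsym mxE.
Qed.

Lemma permmxZ {R : realType} {n} (p : {perm 'I_n}) (a : R) (D : 'M[R]_n) :
  permmx p (a *: D) = a *: permmx p D.
Proof. by apply/matrixP => i j; rewrite !mxE. Qed.

Lemma cvnorm_real {R : realType} {n} (x : 'cV[R]_n) :
  cvnorm (map_mx (real_complex R) x) = Num.sqrt (nsq x).
Proof.
rewrite /cvnorm /nsq; congr Num.sqrt; apply: eq_bigr => i _.
by rewrite mxE /= expr0n addr0 sqrtr_sqr real_normK ?num_real.
Qed.

Lemma eigenvalue_le_opnormC {R : realType} {n} (A : 'M[R]_n) (G a : R) (x : 'cV[R]_n) :
  (opnormC A <= G%:E)%E -> nsq x = 1 -> A *m x = a *: x -> `|a| <= G.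
Proof.
move=> AG x1 Ax; rewrite -lee_fin; apply: le_trans AG.
apply: ereal_sup_ubound; exists (map_mx (real_complex R) x).
  by rewrite /= cvnorm_real x1 sqrtr1.
rewrite /cmx; have -> : map_mx (fun r : R => (r%:C)%C) A = map_mx (real_complex R) A by [].
by rewrite -map_mxM Ax cvnorm_real nsqZ x1 mulr1 sqrtr_sqr.
Qed.

Lemma permmx_eigenvector {R : realType} {n} (p : {perm 'I_n}) (A : 'M[R]_n) (a : R)
    (x : 'cV[R]_n) :
  permmx p A *m x = a *: x ->
  let y : 'cV[R]_n := \col_k x (p^-1%g k) 0 in nsq y = nsq x /\ A *m y = a *: y.
Proof.
move=> /colP Ax y; split.
  rewrite /nsq (reindex_inj (@perm_inj _ p))/=; apply: eq_bigr => k _.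
  by rewrite mxE permK.
apply/colP => k; have := Ax (p^-1%g k); rewrite !mxE => <-.
rewrite (reindex_inj (@perm_inj _ p))/=; apply: eq_bigr => l _.
by rewrite !mxE permK permKV.
Qed.

(** Row [i] of [U], relabelled by the inverse permutation, is a unit eigenvector of [n%:R *: D] for
    [n%:R * d 0 i]. Hence [n] times the modulus of [d 0 i] is at most [G], and [n] is at least 1
    because ['I_n] contains [i]. *)
Lemma permmx_eigenvalue_le {R : realType} {n} (p : {perm 'I_n}) (D U : 'M[R]_n)
    (d : 'rV[R]_n) (G : R) :
  (opnormC (n%:R *: D) <= G%:E)%E -> U *m U^T = 1%:M ->
  permmx p D = U^T *m diag_mx d *m U -> forall i, `|d 0 i| <= G.
Proof.
move=> DG U1 DE i; pose x := (row i U)^T.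
have n1 : 1 <= n%:R :> R by rewrite ler1n (leq_ltn_trans (leq0n i) (ltn_ord i)).
have x1 : nsq x = 1.
  transitivity ((U *m U^T) i i); last by rewrite U1 mxE eqxx.
  by rewrite nsqE /x trmxK !mxE; apply: eq_bigr => k _; rewrite !mxE.
have Dx : permmx p (n%:R *: D) *m x = (n%:R * d 0 i) *: x.
  rewrite permmxZ -scalemxAl -scalerA; congr (_ *: _).
  have diag_delta : diag_mx d *m (delta_mx i 0 : 'cV_n) = d 0 i *: delta_mx i 0.
    apply/colP => k; rewrite mul_diag_mx !mxE.
    by case: eqVneq => [->|]; rewrite ?mulr0.
  rewrite DE /x tr_row colE !mulmxA -(mulmxA _ U) U1 mulmx1 -mulmxA diag_delta.
  by rewrite -scalemxAr.
have [y1 Dy] := permmx_eigenvector _ _ _ _ Dx.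
have := eigenvalue_le_opnormC _ _ _ _ DG (etrans y1 x1) Dy.
rewrite normrM ger0_norm// => /(le_trans _); apply.
by rewrite ler_peMl.
Qed.

(** * Step-kernel operators *)

Section StepOperators.
Context {R : realType}.
Local Notation mu := (@lebesgue_measure R).
Local Notation I01 := (@I01 R).

Let mI01 : measurable I01.
Proof. exact: measurable_itv. Qed.

Lemma chiPE {n} (k : 'I_n) :
  @chiP R n k = \1_(`[k%:R / n%:R, k.+1%:R / n%:R[%classic : set R).
Proof.
apply/funext => u; rewrite /chiP indicE.
by case: ifPn => [uk|/negP uk]; [rewrite mem_set|rewrite memNset];
  rewrite //= in_itv.
Qed.

Lemma measurable_chiP {n} (k : 'I_n) (D : set R) : measurable_fun D (@chiP R n k).
Proof. by rewrite chiPE; apply: measurable_indic; exact: measurable_itv. Qed.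

Lemma chiP_sqr {n} (k : 'I_n) (u : R) : chiP k u ^+ 2 = chiP k u.
Proof. by rewrite /chiP; case: ifP => _; rewrite ?expr0n ?expr1n. Qed.

Lemma chiP_bounded {n} (k : 'I_n) (u : R) : 0 <= chiP k u <= 1.
Proof. by rewrite /chiP; case: ifP => _; rewrite ?lexx ?ler01. Qed.

Lemma chiP_mul_neq {n} (i j : 'I_n) (u : R) : i != j -> chiP i u * chiP j u = 0.
Proof.
move=> ij; have n0 : 0 < n%:R :> R by rewrite ltr0n (leq_ltn_trans _ (ltn_ord i)).
rewrite /chiP; case: ifP => [/andP[i1 i2]|_]; last by rewrite mul0r.
case: ifP => [/andP[j1 j2]|_]; last by rewrite mulr0.
have := le_lt_trans i1 j2; have := le_lt_trans j1 i2.
rewrite !ltr_pM2r ?invr_gt0// !ltr_nat !ltnS => ji ij'.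
by move: ij; rewrite -val_eqE eqn_leq ij' ji.
Qed.

Lemma integrable_chiP {n} (k : 'I_n) : mu.-integrable I01 (EFin \o @chiP R n k).
Proof.
rewrite chiPE; apply: (integrableS measurableT) => //.
exact: integrable_indic_itv.
Qed.

Lemma Rintegral_chiP {n} (k : 'I_n) : \int[mu]_(u in I01) chiP k u = n%:R^-1.
Proof.
have n0 : 0 < n%:R :> R by rewrite ltr0n (leq_ltn_trans _ (ltn_ord k)).
rewrite /Rintegral chiPE integral_indic//.
rewrite (_ : _ `&` I01 = `[k%:R / n%:R, k.+1%:R / n%:R[%classic); last first.
  apply/seteqP; split => [x []//|x /=]; rewrite /I01 /= !in_itv/= => /andP[x1 x2].
  split; rewrite ?x1//; apply/andP; split.
    by apply: le_trans x1; rewrite divr_ge0.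
  apply: le_trans (ltW x2) _; rewrite ler_pdivrMr// mul1r ler_nat.
  exact: ltn_ord.
have muE := @lebesgue_measure_itv R `[k%:R / n%:R, k.+1%:R / n%:R[.
rewrite /= lte_fin ltr_pM2r ?invr_gt0// ltr_nat ltnSn in muE.
by rewrite [X in fine X]muE /= -mulrBl -natrB// subSnn mul1r.
Qed.

Lemma Rintegral_lin_comb {I : finType} (c : I -> R) (f : I -> R -> R) :
  (forall i, mu.-integrable I01 (EFin \o f i)) ->
  mu.-integrable I01 (EFin \o (fun u => \sum_i c i * f i u)) /\
  \int[mu]_(u in I01) (\sum_i c i * f i u) = \sum_i c i * \int[mu]_(u in I01) f i u.
Proof.
move=> intf; have intcf i : mu.-integrable I01 (fun u => (c i * f i u)%:E).
  by rewrite (eq_fun (fun u => EFinM _ _)); apply: integrableZl (intf i).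
split.
  rewrite [X in integrable _ _ X](_ : _ = fun u => (\sum_i (c i * f i u)%:E)%E).
    exact: integrable_sum.
  by apply/funext => u; rewrite /= sumEFin.
rewrite /Rintegral; under eq_integral => u _ do rewrite -sumEFin.
rewrite integral_sum// -sum_fine => [|i _]; last exact: integrable_fin_num.
by apply: eq_bigr => i _; exact: RintegralZl.
Qed.

Lemma L2norm_sqrt (f : R -> R) : mu.-integrable I01 (fun u => (f u ^+ 2)%:E) ->
  L2norm f = (Num.sqrt (\int[mu]_(u in I01) (f u ^+ 2)))%:E.
Proof.
move=> intf; rewrite /L2norm poweR12_sqrt; last first.
  by apply: integral_ge0 => u _; rewrite lee_fin sqr_ge0.
by rewrite -[X in sqrte X]fineK// integrable_fin_num.
Qed.

Definition stepf {n} (y : 'cV[R]_n) (u : R) : R := \sum_k y k 0 * chiP k u.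

Lemma stepf_sqr {n} (y : 'cV[R]_n) (u : R) :
  stepf y u ^+ 2 = \sum_k y k 0 ^+ 2 * chiP k u.
Proof.
rewrite expr2 /stepf mulr_suml; apply: eq_bigr => k _.
rewrite mulr_sumr (bigD1 k)//= big1 ?addr0 => [|l lk].
  by rewrite mulrACA -!expr2 chiP_sqr.
by rewrite mulrACA chiP_mul_neq 1?eq_sym// mulr0.
Qed.

Lemma L2norm_stepf {n} (y : 'cV[R]_n) :
  L2norm (stepf y) = (Num.sqrt (nsq y / n%:R))%:E.
Proof.
have [intf intE] := Rintegral_lin_comb (fun k => y k 0 ^+ 2) _ (@integrable_chiP n).
have fE : (fun u => stepf y u ^+ 2) = (fun u => \sum_k y k 0 ^+ 2 * chiP k u).
  by apply/funext => u; exact: stepf_sqr.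
rewrite L2norm_sqrt; last by under eq_fun => u do rewrite stepf_sqr.
rewrite fE intE /nsq mulr_suml; congr (Num.sqrt _)%:E.
by apply: eq_bigr => k _; rewrite Rintegral_chiP.
Qed.

Lemma measurable_stepf {n} (y : 'cV[R]_n) (D : set R) : measurable_fun D (stepf y).
Proof.
apply: measurable_sum => k; apply: measurable_funM => //.
exact: measurable_chiP.
Qed.

(** Integrals over the cells, not averages: in this normalization [TW (stepW B)] acts through [B]
    itself, and the powers of [n] appear only in the norm estimates. *)
Definition coefs n (psi : R -> R) : 'cV[R]_n :=
  \col_k \int[mu]_(u in I01) (chiP k u * psi u).

Section SquareIntegrable.
Context (psi : R -> R).
Hypothesis mpsi : measurable_fun I01 psi.
Hypothesis intpsi : mu.-integrable I01 (fun u => (psi u ^+ 2)%:E).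

Let integrable_chiP_mul {n} (k : 'I_n) :
  mu.-integrable I01 (EFin \o (fun u => chiP k u * psi u)).
Proof.
(* Dominating function: the modulus of [psi u] is at most [1 + psi u ^+ 2]. *)
have int1 : mu.-integrable I01 (fun u => (1 + psi u ^+ 2)%:E).
  under eq_fun => u do rewrite EFinD.
  apply: integrableD => //.
  have intI : mu.-integrable I01 (EFin \o \1_I01).
    by apply: (integrableS measurableT) => //; exact: integrable_indic_itv.
  apply: le_integrable intI => //.
  by move=> u uI; rewrite /= indicE mem_set.
apply: le_integrable int1 => //.
  by apply/measurable_EFinP; apply: measurable_funM => //; exact: measurable_chiP.
move=> u _; rewrite lee_fin normrM; have /andP[c0 c1] := chiP_bounded k u.
rewrite ger0_norm// [leRHS]ger0_norm ?addr_ge0 ?sqr_ge0//.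
have := normr_ge0 (psi u); rewrite -(real_normK (num_real (psi u))); nra.
Qed.

Lemma TW_stepW {n} (B : 'M[R]_n) : TW (stepW B) psi = stepf (B *m coefs n psi).
Proof.
apply/funext => v; rewrite /TW /stepf.
have WE u : stepW B v u * psi u
    = \sum_j (\sum_i B i j * chiP i v) * (chiP j u * psi u).
  rewrite /stepW exchange_big/= mulr_suml; apply: eq_bigr => j _.
  by rewrite -mulr_suml mulrA.
have [_ intE] := Rintegral_lin_comb (fun j => \sum_i B i j * chiP i v) _
  (@integrable_chiP_mul n).
under eq_integral => u _ do rewrite WE.
rewrite -/(Rintegral _ _ _) intE.
under [RHS]eq_bigr => i _ do rewrite mxE mulr_suml.
rewrite [RHS]exchange_big/=; apply: eq_bigr => j _.
by rewrite mulr_suml; apply: eq_bigr => i _; rewrite mxE mulrAC.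
Qed.

(* Bessel's inequality: expand [0 <= \int (psi - n * stepf (coefs n psi)) ^+ 2]. *)
Lemma nsq_coefs_le n :
  n%:R * nsq (coefs n psi) <= \int[mu]_(u in I01) (psi u ^+ 2).
Proof.
pose c := coefs n psi.
have [intA intAE] := Rintegral_lin_comb (fun k => 2 * n%:R * c k 0) _
  (@integrable_chiP_mul n).
have [intB intBE] := Rintegral_lin_comb (fun k => n%:R ^+ 2 * c k 0 ^+ 2) _
  (@integrable_chiP n).
have : 0 <= \int[mu]_(u in I01) (psi u - n%:R * stepf c u) ^+ 2.
  by apply: Rintegral_ge0 => u _; rewrite sqr_ge0.
have -> : (fun u => (psi u - n%:R * stepf c u) ^+ 2) = (fun u =>
    (psi u ^+ 2 - \sum_k (2 * n%:R * c k 0) * (chiP k u * psi u))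
    + \sum_k n%:R ^+ 2 * c k 0 ^+ 2 * chiP k u).
  apply/funext => u.
  rewrite sqrrB; congr (_ - _ + _).
    by rewrite /stepf !mulr_sumr -sumrMnl; apply: eq_bigr => k _; ring.
  by rewrite exprMn stepf_sqr mulr_sumr; apply: eq_bigr => k _; ring.
rewrite RintegralD//; last first.
  exact: (@integrableB _ _ _ mu _ mI01 _ _ intpsi intA).
rewrite RintegralB// intAE intBE.
have -> : \sum_k 2 * n%:R * c k 0 * \int[mu]_(u in I01) (chiP k u * psi u)
    = 2 * (n%:R * nsq c).
  by rewrite /nsq !mulr_sumr; apply: eq_bigr => k _; rewrite expr2 {3}/c mxE; ring.
have -> : \sum_k n%:R ^+ 2 * c k 0 ^+ 2 * \int[mu]_(u in I01) chiP k u = n%:R * nsq c.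
  rewrite /nsq !mulr_sumr; apply: eq_bigr => k _.
  have n0 : n%:R != 0 :> R by rewrite pnatr_eq0 -lt0n (leq_ltn_trans _ (ltn_ord k)).
  by rewrite Rintegral_chiP; field.
rewrite -/c; lra.
Qed.

End SquareIntegrable.

Lemma coefs_stepf {n} (y : 'cV[R]_n) : coefs n (stepf y) = n%:R^-1 *: y.
Proof.
apply/colP => k; rewrite !mxE.
rewrite (_ : (fun u => _) = (fun u => y k 0 * chiP k u)).
  by rewrite RintegralZl ?Rintegral_chiP 1?mulrC//; exact: integrable_chiP.
apply/funext => u; rewrite /stepf mulr_sumr (bigD1 k)//= big1 ?addr0 => [|l lk].
  by rewrite mulrCA -expr2 chiP_sqr.
by rewrite mulrCA chiP_mul_neq 1?eq_sym// mulr0.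
Qed.

Lemma opsub_TW_stepW (psi : R -> R) {n} (B1 B2 : 'M[R]_n) :
  measurable_fun I01 psi -> mu.-integrable I01 (fun u => (psi u ^+ 2)%:E) ->
  opsub (TW (stepW B1)) (TW (stepW B2)) psi = stepf ((B1 - B2) *m coefs n psi).
Proof.
move=> mpsi intpsi; apply/funext => v; rewrite /opsub !TW_stepW// /stepf -sumrB.
by apply: eq_bigr => k _; rewrite mulmxBl [in RHS]mxE [X in _ = (_ + X) * _]mxE mulrBl.
Qed.

(** Passing to cell integrals costs a factor [1 / n] in squared norm by Bessel's inequality, and
    returning to a step function costs another. So the operator norm is at most the matrix norm
    divided by [n]. *)
Lemma opnormL2_step_le {n} (B1 B2 : 'M[R]_n) (r : R) : 0 <= r ->
  (forall x, nsq ((B1 - B2) *m x) <= (n%:R * r) ^+ 2 * nsq x) ->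
  (opnormL2 (opsub (TW (stepW B1)) (TW (stepW B2))) <= r%:E)%E.
Proof.
move=> r0 hB; apply: ge_ereal_sup => _ [psi /= [mpsi psi1] <-].
(* An infinite integral would make [L2norm psi] infinite, contrary to the bound by 1. *)
have intpsi : mu.-integrable I01 (fun u => (psi u ^+ 2)%:E).
  apply/integrableP; split.
    by apply/measurable_EFinP; exact: measurable_funX.
  under eq_integral => u _ do rewrite gee0_abs ?lee_fin ?sqr_ge0//.
  rewrite ltey; apply: contraTneq psi1 => psioo.
  by rewrite /L2norm psioo poweRyr// gt_eqF// invr_gt0.
have psi_le1 : \int[mu]_(u in I01) (psi u ^+ 2) <= 1.
  move: psi1; rewrite L2norm_sqrt// lee_fin -[X in _ <= X]sqrtr1 ler_sqrt//.
rewrite opsub_TW_stepW// L2norm_stepf lee_fin.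
rewrite -[leRHS](ger0_norm r0) -sqrtr_sqr ler_wsqrtr//.
have [n0|n0] := posnP n.
  have -> : n%:R^-1 = 0 :> R by rewrite n0 invr0.
  by rewrite mulr0 sqr_ge0.
rewrite ler_pdivrMr ?ltr0n//; apply: le_trans (hB _) _.
have := nsq_coefs_le _ mpsi intpsi n => /le_trans /(_ psi_le1); set t := nsq _ => t1.
have -> : (n%:R * r) ^+ 2 * t = (n%:R * t) * (r ^+ 2 * n%:R) by ring.
by rewrite ler_piMl// mulr_ge0 ?sqr_ge0.
Qed.

(** Converse estimate: step functions are test functions, and on them the passage to cell integrals
    loses nothing. *)
Lemma le_opnormL2_step {n} (B1 B2 : 'M[R]_n) (r : R) :
  (opnormL2 (opsub (TW (stepW B1)) (TW (stepW B2))) <= r%:E)%E ->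
  forall x, nsq ((B1 - B2) *m x) <= (n%:R * r) ^+ 2 * nsq x.
Proof.
move=> hr x.
have [x0|x0] := eqVneq (nsq x) 0.
  by rewrite x0 mulr0 (nsq_eq0 x x0) mulmx0 /nsq big1// => i _; rewrite mxE expr0n.
have x_gt0 : 0 < nsq x by rewrite lt0r x0 nsq_ge0.
have n0 : (0 < n)%N.
  rewrite lt0n; apply: contra_neq x0 => n0; rewrite /nsq big1// => -[i i_n].
  by exfalso; rewrite n0 in i_n.
have nR : 0 < n%:R :> R by rewrite ltr0n.
(* The scaling gives [nsq y = n%:R], so that [stepf y] has norm 1. *)
pose a := Num.sqrt (n%:R / nsq x); pose y := a *: x.
have a2 : a ^+ 2 = n%:R / nsq x by rewrite sqr_sqrtr// divr_ge0// ltW.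
have y1 : L2norm (stepf y) = 1%:E.
  by rewrite L2norm_stepf nsqZ a2 divfK// divff ?sqrtr1// gt_eqF.
have inty : mu.-integrable I01 (fun u => (stepf y u ^+ 2)%:E).
  under eq_fun => u do rewrite stepf_sqr.
  by have [] := Rintegral_lin_comb (fun k => y k 0 ^+ 2) _ (@integrable_chiP n).
have my := measurable_stepf y I01.
have : (L2norm (opsub (TW (stepW B1)) (TW (stepW B2)) (stepf y)) <= r%:E)%E.
  apply: le_trans hr; apply: ereal_sup_ubound; exists (stepf y) => //=.
  by rewrite y1.
rewrite opsub_TW_stepW// coefs_stepf L2norm_stepf lee_fin => hle.
have r0 : 0 <= r by apply: le_trans hle.
move: hle; rewrite -[leRHS](ger0_norm r0) -sqrtr_sqr ler_sqrt ?sqr_ge0//.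
rewrite ler_pdivrMr// -scalemxAr /y -scalemxAr !nsqZ a2 exprVn.
set t := nsq (_ *m x).
have -> : n%:R ^- 2 * (n%:R / nsq x * t) = t / (n%:R * nsq x).
  by field; rewrite x0 gt_eqF.
rewrite ler_pdivrMr ?mulr_gt0// => /le_trans; apply.
by rewrite le_eqVlt; apply/orP; left; apply/eqP; ring.
Qed.

End StepOperators.

(** * Common refinement of partitions *)

Section Refinement.
Context {R : realType}.

(** Written as a difference of two thresholds, the indicators of consecutive cells telescope, which
    gives the refinement of a cell into subcells. *)
Lemma chiP_telescope {n} (k : 'I_n) (u : R) :
  chiP k u = (k%:R / n%:R <= u)%R%:R - (k.+1%:R / n%:R <= u)%R%:R.
Proof.
have n0 : 0 < n%:R :> R by rewrite ltr0n (leq_ltn_trans _ (ltn_ord k)).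
have kk : k%:R / n%:R <= k.+1%:R / n%:R :> R by rewrite ler_pM2r ?invr_gt0// ler_nat.
rewrite /chiP; case: (leP (k.+1%:R / n%:R) u) => [ku|_].
  by rewrite (le_trans kk ku) subrr.
by rewrite andbT subr0; case: ifP.
Qed.

Lemma sum_divn_eq {n m} (i : 'I_n) (f : nat -> R) : (0 < m)%N ->
  \sum_(k < m * n | (k %/ m == i)%N) f k = \sum_(i * m <= k < i.+1 * m) f k.
Proof.
move=> m0; rewrite (big_nat_widen _ _ (m * n)); last first.
  by rewrite mulnC leq_pmul2l.
rewrite (big_nat_widenl _ 0)//= big_mkord; apply: eq_bigl => k.
by rewrite eqn_leq -ltnS ltn_divLR// leq_divRL// andbC mulnC.
Qed.

Lemma chiP_refine {n m} (i : 'I_n) (u : R) : (0 < m)%N ->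
  chiP i u = \sum_(k < m * n | (k %/ m == i)%N) chiP k u.
Proof.
move=> m0; under eq_bigr => k _ do rewrite chiP_telescope -opprB.
rewrite (sum_divn_eq i (fun k => - ((k.+1%:R / (m * n)%:R <= u)%R%:R
                                    - (k%:R / (m * n)%:R <= u)%R%:R))) // sumrN.
rewrite (telescope_sumr (fun k => (k%:R / (m * n)%:R <= u)%R%:R)) ?leq_pmul2r//.
rewrite opprB chiP_telescope.
have mR : m%:R != 0 :> R by rewrite pnatr_eq0 -lt0n.
have divE a : (a * m)%:R / (m * n)%:R = a%:R / n%:R :> R.
  by rewrite mulnC !natrM -mulf_div divff// mul1r.
by rewrite !divE.
Qed.

Lemma stepW_mx {n} (B : 'M[R]_n) (u v : R) :
  stepW B u v = ((\row_i chiP i u) *m B *m (\row_j chiP j v)^T) 0 0.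
Proof.
rewrite /stepW exchange_big mxE/=; apply: eq_bigr => j _.
rewrite !mxE mulr_suml; apply: eq_bigr => i _.
by rewrite mxE (mulrC (B i j)).
Qed.

(** The columns of [J] are the normalized indicators of the blocks of [m = N / n] subcells, with
    entries [1 / sqrt m]. Conjugation by [J] thus divides the entries of [B] by [m], which turns the
    factor [N] into [n]. Writing [n.-1.+1] admits [n = 0], where both kernels vanish. *)
Lemma stepW_refine (n N : nat) : (0 < N)%N -> (n.-1.+1 %| N)%N ->
  exists J : 'M[R]_(N, n), J^T *m J = 1%:M /\
    forall B : 'M[R]_n, stepW (n%:R *: B) = stepW (N%:R *: (J *m B *m J^T)).
Proof.
case: n => [|n] N0.
  exists 0; split; first by rewrite [LHS]flatmx0 [RHS]flatmx0.
  move=> B; apply/funext => u; apply/funext => v.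
  rewrite {1}/stepW big_ord0 !mul0mx scaler0 stepW_mx mulmx0 mul0mx.
  by rewrite mxE.
move=> /= /dvdnP[m NE]; subst N.
have m0 : (0 < m)%N by case: m N0.
have mR : 0 < m%:R :> R by rewrite ltr0n.
pose s : R := Num.sqrt m%:R.
have s2 : s * s = m%:R by rewrite -expr2 sqr_sqrtr// ltW.
have s0 : s != 0 by rewrite gt_eqF// sqrtr_gt0.
pose J : 'M[R]_(m * n.+1, n.+1) := \matrix_(k, i) if (k %/ m == i)%N then s^-1 else 0.
exists J; split.
  apply/matrixP => i j; rewrite !mxE.
  transitivity (\sum_(k < m * n.+1 | (k %/ m == i)%N) (i == j)%:R / m%:R : R).
    rewrite [RHS]big_mkcond/=; apply: eq_bigr => k _; rewrite !mxE.
    case: ifP => [/eqP ->|_]; last by rewrite mul0r.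
    rewrite val_eqE; case: eqVneq => _; last by rewrite mulr0 mul0r.
    by rewrite -invfM s2 mul1r.
  rewrite (sum_divn_eq i (fun=> _))// sumr_const_nat -mulnBl subSnn mul1n.
  by rewrite -[LHS]mulr_natr divfK// gt_eqF.
move=> B; apply/funext => u; apply/funext => v.
have chiJ w : \row_i chiP i w = s *: ((\row_k chiP k w) *m J) :> 'rV[R]_n.+1.
  apply/rowP => i; rewrite !mxE (chiP_refine i w m0) mulr_sumr big_mkcond/=.
  apply: eq_bigr => k _; rewrite !mxE; case: ifP => _; last by rewrite !mulr0.
  by rewrite mulrCA divff// mulr1.
rewrite !stepW_mx !chiJ; congr (fun_of_matrix _ 0 0).
set cu := \row_k chiP k u; set cv := \row_k chiP k v.
have -> : (s *: (cv *m J))^T = s *: (J^T *m cv^T) by rewrite linearZ/= trmx_mul.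
rewrite -?scalemxAr -?scalemxAl -?scalemxAr -?scalemxAl !scalerA !mulmxA.
by congr (_ *: _); rewrite natrM -s2; ring.
Qed.

Lemma opnormL2_ge0 (T : (R -> R) -> R -> R) : (0 <= opnormL2 T)%E.
Proof.
apply: (@le_trans _ _ (L2norm (T (cst 0)))); first exact: poweR_ge0.
apply: ereal_sup_ubound; exists (cst 0) => //; split=> /=; first exact: measurable_cst.
rewrite /L2norm (_ : (fun x => _) = cst 0%E).
  by rewrite integral0 poweR12_sqrt//= sqrtr0 lee_fin.
by apply/funext => x; rewrite expr0n.
Qed.

End Refinement.

(** * Transfer of the matrix estimate to graph operators *)

(** One eigendecomposition of the permuted shift operator, transported by the isometry [J],
    describes both kernels: [X = U J^T] has orthonormal rows, and only the diagonal changes from [d]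
    to its image under [h]. *)
Lemma fcalc_refine {R : realType} (h : R -> R) {n N : nat} (p : {perm 'I_n}) (D : 'M[R]_n)
    (G : R) :
  (0 < N)%N -> (n.-1.+1 %| N)%N -> symmx D -> (opnormC (n%:R *: D) <= G%:E)%E ->
  exists (X : 'M[R]_(n, N)) (d : 'rV[R]_n),
    [/\ X *m X^T = 1%:M, forall i, `|d 0 i| <= G,
        stepW (permmx p (n%:R *: D)) = stepW (N%:R *: (X^T *m diag_mx d *m X)) &
        stepW (n%:R *: fcalc h (permmx p D))
          = stepW (N%:R *: (X^T *m diag_mx (map_mx h d) *m X))].
Proof.
move=> N0 nN Dsym DG; have [J [J1 JE]] := @stepW_refine R n N N0 nN.
have [U [d [U1 U2 DE ->]]] := fcalcP h _ (symmx_permmx p D Dsym).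
exists (U *m J^T), d; split.
- by rewrite trmx_mul trmxK mulmxA -(mulmxA U) J1 mulmx1.
- exact: permmx_eigenvalue_le DG U2 DE.
- by rewrite permmxZ JE DE trmx_mul trmxK !mulmxA.
- by rewrite JE trmx_mul trmxK !mulmxA.
Qed.

Theorem theorem5p6 (R : realType) (Gam : nat) (h : R -> R) :
  C1_lipderiv (Gam%:R) h -> h 0 = 0 ->
  exists C : R, 0 < C /\
    forall (n1 n2 : nat) (D1 : 'M[R]_n1) (D2 : 'M[R]_n2),
      symmx D1 -> symmx D2 ->
      (opnormC (n1%:R *: D1) <= (Gam%:R)%:E)%E ->
      (opnormC (n2%:R *: D2) <= (Gam%:R)%:E)%E ->
      forall (p1 : {perm 'I_n1}) (p2 : {perm 'I_n2}),
        (opnormL2 (opsub (TW (stepW (n1%:R *: fcalc h (permmx p1 D1))))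
                         (TW (stepW (n2%:R *: fcalc h (permmx p2 D2)))))
         <= C%:E * opnormL2 (opsub (TW (stepW (permmx p1 (n1%:R *: D1))))
                                   (TW (stepW (permmx p2 (n2%:R *: D2))))))%E.
Proof.
move=> hC1 h0.
have [C [C0 hC]] := lipschitz_calculus Gam%:R h (ler0n _ _) hC1 h0.
exists C; split=> // n1 n2 D1 D2 D1sym D2sym D1G D2G p1 p2.
(* A common multiple of the two sizes that stays positive when a graph is empty. *)
pose N := (n1.-1.+1 * n2.-1.+1)%N.
have N0 : (0 < N)%N by [].
have [X1 [d1 [X11 d1G -> ->]]] :=
  fcalc_refine h p1 D1 _ N0 (dvdn_mulr _ (dvdnn _)) D1sym D1G.
have [X2 [d2 [X21 d2G -> ->]]] :=
  fcalc_refine h p2 D2 _ N0 (dvdn_mull _ (dvdnn _)) D2sym D2G.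
set S1 := X1^T *m diag_mx d1 *m X1; set S2 := X2^T *m diag_mx d2 *m X2.
have := opnormL2_ge0 (opsub (TW (stepW (N%:R *: S1))) (TW (stepW (N%:R *: S2)))).
(* If the norm on the right is infinite, the positive [C] keeps the bound infinite. Otherwise its
   value [r] serves as the matrix bound, and the common factor [N] cancels. *)
case: (opnormL2 _) (le_opnormL2_step (N%:R *: S1) (N%:R *: S2)) => [r||//]; last first.
  by rewrite gt0_muley ?leey.
rewrite lee_fin => /(_ r (lexx _)) hS r0.
have NR : 0 < N%:R :> R by rewrite ltr0n.
have hS' x : nsq ((S1 - S2) *m x) <= r ^+ 2 * nsq x.
  have := hS x; rewrite -scalerBr -scalemxAl nsqZ exprMn -[leRHS]mulrA ler_pM2l//.
  by rewrite exprn_gt0.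
rewrite -EFinM; apply: opnormL2_step_le; first by rewrite mulr_ge0// ltW.
move=> x; rewrite -scalerBr -scalemxAl nsqZ [X in _ <= X * _]exprMn -[leRHS]mulrA.
by rewrite ler_wpM2l ?sqr_ge0//; apply: hC.
Qed.
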